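(* Let $m\ge1$, let $x_1,\dots,x_m$ be pairwise distinct variables, and let $t\neq1$ be a parameter. For any nonempty subset $J\subseteq\{1,\ldots,m\}$, $$ \det(N_J)=t^{\binom{|J|}{2}}\prod_{i\in J}\ \prod_{j\in\{1,\dots,m\}\setminus J}f_{ij}. $$ In particular $\det(N)=t^{\binom m2}$, and $\det(N_\emptyset)=1$ by the usual convention.
   Context: For $i\ne j$ in $\{1,\dots,m\}$ put $$f_{ij}=\frac{t x_j-x_i}{x_j-x_i}.$$ $N$ is the $m\times m$ matrix with entries $$ N_{ii}=\prod_{k\neq i}f_{ik},\qquad N_{ij}=(f_{ij}-1)\prod_{k\notin\{i,j\}}f_{ik}\quad(i\neq j), $$ where $k$ ranges over $\{1,\dots,m\}$. For $J\subseteq\{1,\dots,m\}$, $N_J$ is the principal submatrix of $N$ with rows and columns indexed by $J$. Empty products equal $1$. *)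

(* Defs.v *)
From mathcomp Require Import all_boot all_algebra.
Set Implicit Arguments.
Unset Strict Implicit.
Unset Printing Implicit Defensive.

Import GRing.Theory.
Local Open Scope ring_scope.

(* The variables are the values of [x : 'I_m -> F], elements of an arbitrary
   field [F]; taking for [F] a field of rational functions gives the case of
   indeterminates. *)

(* Only used for i != j: for i = j the denominator is 0, and the quotient is 0
   by MathComp's convention on inverses. *)
Definition f (F : fieldType) (m : nat) (t : F) (x : 'I_m -> F) (i j : 'I_m) : F :=
  (t * x j - x i) / (x j - x i).

Definition N (F : fieldType) (m : nat) (t : F) (x : 'I_m -> F) : 'M[F]_m :=
  \matrix_(i, j)
    if i == j then \prod_(k | k != i) f t x i k
    else (f t x i j - 1) * \prod_(k | k \notin [set i; j]) f t x i k.

(* [enum_val] lists the elements of [J] in increasing order. *)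
Definition principal_submx (F : fieldType) (m : nat) (A : 'M[F]_m)
    (J : {set 'I_m}) : 'M[F]_#|J| :=
  mxsub enum_val enum_val A.

(* Main.v *)
Require Import Defs.
From mathcomp Require Import all_boot all_fingroup all_algebra.
Set Implicit Arguments.
Unset Strict Implicit.

Import GRing.Theory.
Local Open Scope ring_scope.

(** The determinant of the full matrix does not depend on the nodes. Put
    D_i = \prod_(k != i) (x_k - x_i).
    Off the diagonal, N_ij carries a factor x_j. Replacing this factor by x_i
    leaves the determinant unchanged ([det_twist]: in each Leibniz term both
    versions contribute the product of x over the points moved by the
    permutation), also when some x_i vanishes and conjugation by diag(x) is not
    available. The new matrix has the entries
    \prod_(k != j) (t x_k - x_i) / D_i, the value at x_i of the Lagrange
    numerator L_j(X) = \prod_(k != j) (t x_k - X), divided by D_i.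

    The polynomial L_j is homogeneous of degree m - 1 in t and X: its
    coefficient of X^s is t^(m-1-s) times the one for t = 1
    ([coef_prod_scaled]). So the matrix (L_j(x_i)) factors as
    V diag(t^(m-1-s)) C, with V the Vandermonde matrix and C the coefficients
    for t = 1, while V C is the diagonal matrix of the D_j
    ([det_lagrange_numerators]). Hence det N = t^(0 + 1 + ... + (m-1)), for
    every t, zero included ([det_N]).

    For a subset J, row i of N_J is \prod_(k \notin J) f_ik times row i of the
    same matrix built on the nodes indexed by J ([principal_submx_N]). *)

(** * Replacing a column factor by a row factor *)

(** A permutation maps the set of its non-fixed points to itself, so the
    product of [y (s i)] over them equals the product of [y i]. *)
Lemma det_twist (R : comNzRingType) (n : nat) (y : 'I_n -> R)
    (A A' B : 'M[R]_n) :
  (forall i, A i i = A' i i) ->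
  (forall i j, i != j -> A i j = B i j * y j /\ A' i j = B i j * y i) ->
  \det A = \det A'.
Proof.
move=> eq_diag eq_off; apply: eq_bigr => s _; congr (_ * _).
rewrite (bigID (fun i => (s : 'S_n) i == i)) /=.
rewrite [RHS](bigID (fun i => (s : 'S_n) i == i)) /=.
congr (_ * _); first by apply: eq_bigr => i /eqP ->.
under eq_bigr => i si do rewrite (eq_off _ _ _).1 1?eq_sym //.
under [RHS]eq_bigr => i si do rewrite (eq_off _ _ _).2 1?eq_sym //.
rewrite !big_split /=; congr (_ * _).
rewrite [RHS](reindex_inj (@perm_inj _ s)) /=.
by apply: eq_bigl => i; rewrite (inj_eq perm_inj).
Qed.

(** * Lagrange numerators *)

Lemma size_prod_linear_le (R : comNzRingType) (I : Type) (a : I -> R)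
    (r : seq I) :
  (size (\prod_(k <- r) ((a k)%:P - 'X))%R <= (size r).+1)%N.
Proof.
elim: r => [|k r IH]; first by rewrite big_nil size_poly1.
rewrite big_cons; apply: leq_trans (size_polyMleq _ _) _.
have : (size ((a k)%:P - 'X : {poly R})%R <= 2)%N.
  by rewrite -opprB size_polyN size_XsubC.
by move/leq_add/(_ IH); rewrite addSn -ltnS; case: (_ + _)%N.
Qed.

(** Homogeneity of \prod_k (t a_k - X) in (t, X). The truncated exponent does
    no harm: for [s > size r] both coefficients are 0. *)
Lemma coef_prod_scaled (R : comNzRingType) (I : Type) (t : R) (a : I -> R)
    (r : seq I) (s : nat) :
  (\prod_(k <- r) ((t * a k)%:P - 'X) : {poly R})`_s
  = t ^+ (size r - s) * (\prod_(k <- r) ((a k)%:P - 'X) : {poly R})`_s.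
Proof.
elim: r s => [|k r IH] s.
  by rewrite !big_nil sub0n mul1r.
rewrite !big_cons !mulrBl !coefB !coefCM !coefXM !IH mulrBr /=.
congr (_ - _); last by case: s => [|s] /=; rewrite ?mulr0.
have [le_s|lt_s] := leqP s (size r).
  by rewrite subSn // exprS; rewrite -!mulrA; congr (_ * _); rewrite mulrCA.
by rewrite (nth_default _ (leq_trans (size_prod_linear_le _ _) lt_s)) !mulr0.
Qed.

Lemma card_predC1_ord (m : nat) (j : 'I_m) :
  size [seq k <- index_enum 'I_m | k != j] = m.-1.
Proof.
rewrite -[RHS](congr1 predn (card_ord m)) -(cardC1 j) cardE /enum_mem.
by congr size.
Qed.

Definition lagrange_num (R : comNzRingType) (m : nat) (x : 'I_m -> R) (t : R)
    (j : 'I_m) : {poly R} :=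
  \prod_(k | k != j) ((t * x k)%:P - 'X).

Lemma horner_lagrange_num (R : comNzRingType) (m : nat) (x : 'I_m -> R) (t : R)
    (j : 'I_m) (y : R) :
  (lagrange_num x t j).[y] = \prod_(k | k != j) (t * x k - y).
Proof. by rewrite horner_prod; apply: eq_bigr => k _; rewrite !hornerE. Qed.

Lemma coef_lagrange_num (R : comNzRingType) (m : nat) (x : 'I_m -> R) (t : R)
    (j : 'I_m) (s : nat) :
  (lagrange_num x t j)`_s = t ^+ (m.-1 - s) * (lagrange_num x 1 j)`_s.
Proof.
rewrite /lagrange_num -!(big_filter _ (fun k => k != j)).
rewrite (coef_prod_scaled _ x) card_predC1_ord.
by under [in RHS]eq_bigr do rewrite mul1r.
Qed.

Lemma size_lagrange_num (R : comNzRingType) (m : nat) (x : 'I_m -> R) (t : R)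
    (j : 'I_m) : (size (lagrange_num x t j) <= m)%N.
Proof.
rewrite /lagrange_num -big_filter.
apply: leq_trans (size_prod_linear_le (fun k => t * x k) _) _.
by rewrite card_predC1_ord prednK // (leq_ltn_trans _ (ltn_ord j)).
Qed.

Lemma prod_exprs (R : comNzRingType) (m : nat) (t : R) :
  \prod_(s < m) t ^+ (m.-1 - s) = t ^+ 'C(m, 2).
Proof.
rewrite prodrXr -bin2_sum big_mkord (reindex_inj rev_ord_inj) /=.
congr (t ^+ _); apply: eq_bigr => i _.
by have:= ltn_ord i; case: m i => [[]|m] //= i lt_im; rewrite subSS subKn.
Qed.

(** The factor t^(m-1-s) of the coefficients sits between the Vandermonde
    matrix and the coefficient matrix for t = 1, so the determinant is a
    power of t times its value at t = 1. There the numerators vanish at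
    all nodes but their own, and the matrix is diagonal. *)
Lemma det_lagrange_numerators (R : comNzRingType) (m : nat) (x : 'I_m -> R)
    (t : R) :
  \det (\matrix_(i < m, j < m) \prod_(k | k != j) (t * x k - x i))
  = t ^+ 'C(m, 2) * \prod_i \prod_(k | k != i) (x k - x i).
Proof.
pose V : 'M[R]_m := \matrix_(i, s) x i ^+ s.
pose E t : 'M[R]_m := diag_mx (\row_s t ^+ (m.-1 - s)).
pose C : 'M[R]_m := \matrix_(s, j) (lagrange_num x 1 j)`_s.
have factor u :
    \matrix_(i < m, j < m) \prod_(k | k != j) (u * x k - x i) = V *m E u *m C.
  apply/matrixP => i j; rewrite mxE -horner_lagrange_num.
  rewrite (horner_coef_wide _ (size_lagrange_num _ _ _)) mxE.
  apply: eq_bigr => s _; rewrite mul_mx_diag !mxE coef_lagrange_num.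
  by rewrite mulrC mulrA.
have diag1 : V *m C = diag_mx (\row_i \prod_(k | k != i) (x k - x i)).
  have -> : V = V *m E 1.
    by apply/matrixP => i s; rewrite mul_mx_diag !mxE expr1n mulr1.
  rewrite -factor; apply/matrixP => i j; rewrite !mxE.
  have [->|ne_ij] := eqVneq i j.
    by rewrite mulr1n; apply: eq_bigr => k _; rewrite mul1r.
  by rewrite mulr0n (bigD1 i) //= mul1r subrr mul0r.
rewrite factor !det_mulmx det_diag mulrAC -det_mulmx diag1 det_diag mulrC.
congr (_ * _); last by apply: eq_bigr => i _; rewrite mxE.
by rewrite -prod_exprs; apply: eq_bigr => s _; rewrite mxE.
Qed.

(** * The full matrix *)

Lemma f_sub1 (F : fieldType) (m : nat) (t : F) (x : 'I_m -> F) (i j : 'I_m) :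
  x j != x i -> f t x i j - 1 = (t - 1) / (x j - x i) * x j.
Proof.
rewrite -subr_eq0 => nz; rewrite /f -[X in _ - X](divff nz) -mulrBl.
by rewrite mulrAC; congr (_ / _); rewrite opprB addrA subrK mulrBl mul1r.
Qed.

Lemma det_N (F : fieldType) (m : nat) (x : 'I_m -> F) (t : F) :
  injective x -> \det (N t x) = t ^+ 'C(m, 2).
Proof.
move=> x_inj.
have nz i k : k != i -> x k - x i != 0 by rewrite subr_eq0 (inj_eq x_inj).
pose D i := \prod_(k | k != i) (x k - x i).
have Dnz i : D i != 0 by apply/prodf_neq0 => k; apply: nz.
pose L := \matrix_(i < m, j < m) \prod_(k | k != j) (t * x k - x i).
pose B := \matrix_(i < m, j < m)
  ((t - 1) / (x j - x i) * \prod_(k | k \notin [set i; j]) f t x i k).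
rewrite (@det_twist _ _ x _ (diag_mx (\row_i (D i)^-1) *m L) B); first last.
- move=> i j ne_ij; have ne_ji : j != i by rewrite eq_sym.
  rewrite mul_diag_mx !mxE (negPf ne_ij).
  split; first by rewrite f_sub1 ?(inj_eq x_inj) // mulrAC.
  (* The factor k = i of the numerator is (t - 1) x_i; the factor k = j of D_i
     is the denominator in B. *)
  rewrite (bigD1 i) //= /D (bigD1 j) //= /f big_split /= prodfV invfM.
  have -> : t * x i - x i = (t - 1) * x i by rewrite mulrBl mul1r.
  have predE k : (k != i) && (k != j) = (k \notin [set i; j]).
    by rewrite !inE negb_or.
  have predE' k : (k != j) && (k != i) = (k \notin [set i; j]).
    by rewrite andbC predE.
  rewrite !(eq_bigl _ _ predE) !(eq_bigl _ _ predE').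
  rewrite mulrC [_ * x i * _]mulrAC [LHS]mulrAC.
  by congr (_ * _); rewrite mulrACA.
- move=> i; rewrite mul_diag_mx !mxE eqxx /f big_split /= prodfV.
  by rewrite mulrC.
rewrite det_mulmx det_diag det_lagrange_numerators mulrCA -big_split /=.
by rewrite big1 ?mulr1 // => i _; rewrite mxE mulVf // Dnz.
Qed.

(** * Principal submatrices *)

Lemma prod_split_enum_val (R : comNzRingType) (m : nat) (J : {set 'I_m})
    (P : pred 'I_m) (g : 'I_m -> R) :
  {in ~: J, forall k, P k} ->
  \prod_(k | P k) g k
  = \prod_(k in ~: J) g k
    * \prod_(c < #|J| | P (enum_val c)) g (enum_val c).
Proof.
move=> PJ; rewrite (bigID (mem J)) /= mulrC; congr (_ * _).
  apply: eq_bigl => k; rewrite inE; have [|kJ] := boolP (k \in J).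
    by rewrite andbF.
  by rewrite PJ // inE.
rewrite -(big_enum_val_cond P g).
by apply: eq_bigl => k; rewrite andbC.
Qed.

(** For i and j in J, the factors f_ik with k outside J occur in both kinds of
    entries of row i, and the remaining ones only involve the nodes in J. *)
Lemma principal_submx_N (F : fieldType) (m : nat) (x : 'I_m -> F) (t : F)
    (J : {set 'I_m}) :
  principal_submx (N t x) J
  = diag_mx (\row_(a < #|J|) \prod_(k in ~: J) f t x (enum_val a) k)
    *m N t (x \o (fun a : 'I_#|J| => enum_val a)).
Proof.
apply/matrixP => a b; rewrite mul_diag_mx !mxE (inj_eq enum_val_inj).
case: eqP => [_|_].
  rewrite (@prod_split_enum_val _ _ J); first last.
    by move=> k; rewrite inE; apply: contraNneq => ->; apply: enum_valP.
  by congr (_ * _); apply: eq_bigl => c; rewrite (inj_eq enum_val_inj).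
rewrite (@prod_split_enum_val _ _ J); first last.
  by move=> k; rewrite !inE; apply: contra => /orP[]/eqP->; exact: enum_valP.
rewrite mulrCA; congr (_ * (_ * _)).
by apply: eq_bigl => c; rewrite !inE !(inj_eq enum_val_inj).
Qed.

Unset Implicit Arguments.
Set Strict Implicit.

Theorem theoremB1 (F : fieldType) (m : nat) (hm : (1 <= m)%N)
    (x : 'I_m -> F) (hx : injective x) (t : F) (ht : t != 1) :
  (forall J : {set 'I_m}, J != set0 ->
     \det (principal_submx (N t x) J)
     = t ^+ 'C(#|J|, 2) * \prod_(i in J) \prod_(j in ~: J) f t x i j)
  /\ \det (N t x) = t ^+ 'C(m, 2)
  /\ \det (principal_submx (N t x) set0) = 1.
Proof.
have detJ (J : {set 'I_m}) :
    \det (principal_submx (N t x) J)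
    = t ^+ 'C(#|J|, 2) * \prod_(i in J) \prod_(j in ~: J) f t x i j.
  rewrite principal_submx_N det_mulmx det_diag mulrC det_N; last first.
    exact: inj_comp hx enum_val_inj.
  congr (_ * _); rewrite [RHS]big_enum_val /=.
  by apply: eq_bigr => a _; rewrite mxE.
split; first by move=> J _; apply: detJ.
split; first exact: det_N.
by rewrite detJ cards0 big_set0 mulr1.
Qed.
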